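(* Assume $d/p\le k$. For every bounded sequence $\{f_n\}_{n\in\mathbb N}\subset\dot V_p^k$ (that is, $\sup_n|f_n|_{V_p^k}<\infty$) there are an infinite subset $J\subset\mathbb N$ and a sequence of polynomials $\{p_n\}_{n\in J}\subset\mathcal P_{k-1}^d$ such that the sequence $\{f_n+p_n\}_{n\in J}$ converges pointwise on $Q^d$ to some $f\in\dot V_p^k$ and, moreover, $$|f|_{V_p^k}\le\varliminf_{n\in J}|f_n|_{V_p^k}.$$
   Context: Fix $d,k\in\mathbb N$, $1\le p<\infty$, and let $Q^d:=[0,1]^d$. A cube is a closed cube in $\mathbb R^d$ homothetic to $Q^d$. A packing is a family of cubes with pairwise disjoint interiors; $\Pi$ is the set of finite packings consisting of cubes contained in $Q^d$. $\mathcal P_{k-1}^d$ is the space of real polynomials on $\mathbb R^d$ of degree at most $k-1$. $\ell_\infty(Q^d)$ is the space of all bounded functions $f:Q^d\to\mathbb R$. For a cube $Q\subset Q^d$, $E_k(f;Q):=\inf_{m\in\mathcal P_{k-1}^d}\sup_Q|f-m|$. The space $\dot V_p^k$ consists of all $f\in\ell_\infty(Q^d)$ such that $$|f|_{V_p^k}:=\sup_{\pi\in\Pi}\Big(\sum_{Q\in\pi}E_k(f;Q)^p\Big)^{1/p}<\infty,$$ and is equipped with the seminorm $|\cdot|_{V_p^k}$. *)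

(* Defs.v *)
From mathcomp Require Import all_boot all_order all_algebra.
(* Without its notations, which clash with those of MathComp-Analysis. *)
From mathcomp Require Import (coercions, canonicals) mpoly.
From mathcomp Require Import all_classical all_reals all_analysis.

Set Implicit Arguments.
Unset Strict Implicit.
Unset Printing Implicit Defensive.

Import Order.TTheory GRing.Theory Num.Theory.
Import numFieldNormedType.Exports.

Local Open Scope classical_set_scope.
Local Open Scope ring_scope.

Definition unit_cube (R : realType) (d : nat) : set 'rV[R]_d :=
  [set x | forall i, 0 <= x ord0 i <= 1].
Arguments unit_cube : clear implicits.

(* A negative ratio of homothety gives no further cubes, by the symmetry of
   [unit_cube]. *)
Definition is_cube (R : realType) (d : nat) (Q : set 'rV[R]_d) : Prop :=
  exists (a : 'rV[R]_d) (s : R),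
    0 < s /\ Q = (fun x => a + s *: x) @` unit_cube R d.

(* [trivIset] says that distinct members have disjoint interiors; a cube has a
   nonempty interior, so nothing is lost by taking a set of cubes rather than
   an indexed family. *)
Definition packing (R : realType) (d : nat) (pi : set (set 'rV[R]_d)) : Prop :=
  (forall Q, pi Q -> is_cube Q) /\ trivIset pi (fun Q => interior Q).

Definition finite_packings (R : realType) (d : nat) :
    set (set (set 'rV[R]_d)) :=
  [set pi | [/\ finite_set pi, packing pi &
                forall Q, pi Q -> Q `<=` unit_cube R d]].
Arguments finite_packings : clear implicits.

(* The space P_{k-1}^d: [msize] is the total degree plus one, and 0 for the
   zero polynomial. *)
Definition polys (R : realType) (d k : nat) : set (mpoly.mpoly d R) :=
  [set m | (mpoly.msize m <= k)%N].
Arguments polys : clear implicits.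

Definition peval (R : realType) (d : nat) (m : mpoly.mpoly d R)
    (x : 'rV[R]_d) : R :=
  mpoly.meval (fun i => x ord0 i) m.

(* Functions on the unit cube are represented by total functions on R^d, of
   which only the values on the unit cube are ever used. *)
Definition Ek (R : realType) (d k : nat) (f : 'rV[R]_d -> R)
    (Q : set 'rV[R]_d) : \bar R :=
  ereal_inf [set ereal_sup [set `|f x - peval m x|%:E | x in Q]
            | m in polys R d k].

Definition Vseminorm (R : realType) (d k : nat) (p : R) (f : 'rV[R]_d -> R) :
    \bar R :=
  ereal_sup [set ((\sum_(Q \in pi) (Ek k f Q `^ p)) `^ p^-1)%E
            | pi in finite_packings R d].

Definition Vspace (R : realType) (d k : nat) (p : R) : set ('rV[R]_d -> R) :=
  [set f | [bounded f x | x in unit_cube R d] /\ (Vseminorm k p f < +oo)%E].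
Arguments Vspace : clear implicits.

(* Main.v *)
Require Import Defs.
From mathcomp Require Import all_boot all_order all_algebra.
From mathcomp Require Import (coercions, canonicals) mpoly.
From mathcomp Require qpoly.
From mathcomp Require Import all_classical all_reals all_analysis.
From mathcomp Require Import finmap ring lra.

Import Order.TTheory GRing.Theory Num.Theory.
Import numFieldNormedType.Exports.

Local Open Scope classical_set_scope.
Local Open Scope ring_scope.

(** After adding polynomials of degree less than [k], the functions [f n] are
    uniformly bounded on the unit cube, because the packing reduced to the unit
    cube itself bounds [Ek k (f n)] there.  Call [g n] the corrected functions;
    they have the same seminorms as the [f n].

    Take a nonprincipal ultrafilter [U] on the natural numbers and let [h] be the
    pointwise limit of [g] along [U].  Fix [e > 0] and cut the unit cube into
    equal grid cells.  A cell is good when [Ek k (g n)] is at most [e] on it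
    for [U]-many [n].  If many cells of one grid were not good, a single [n]
    would make [Ek k (g n)] exceed [e] on all of them, and they form a packing:
    so the bound on the seminorms limits their number, uniformly in the grid.
    Distinct points eventually lie in distinct cells, hence only finitely many
    points have no good cell at any level ([finite_bad_points]).  On a good
    cell the near-optimal polynomials are bounded, so their coefficients are
    bounded ([mcoeff_le_sup_cube]) and they converge along [U] uniformly; hence
    [g n] is uniformly within a multiple of [e] of [h] on this cell, for
    [U]-many [n] ([ultra_uniform_on_good_cube]).

    Therefore countably many members of [U], one for each [e = 1 / (m + 1)] and
    each grid, control [h - g n] at every point of the unit cube: through the
    good cells, or through the finite set of exceptional points.  An infinite
    set [J] almost contained in each of these members is the required
    subsequence ([pointwise_convergent_subsequence]).

    Compactness of polynomials also gives the semicontinuity: a pointwise limit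
    of uniformly bounded functions which are close to polynomials is close to a
    limit polynomial ([Ek_lower_semicontinuous]).  Comparing finite sums over
    one packing at a time then gives the inequality between the seminorms. *)

(** * Coefficients and values of polynomials *)

Lemma polys_opp {R : realType} {d k : nat} {m : mpoly.mpoly d R} :
  polys R d k m -> polys R d k (- m).
Proof. by rewrite /polys /= mpoly.msizeN. Qed.

Lemma polys_sub {R : realType} {d k : nat} {m q : mpoly.mpoly d R} :
  polys R d k m -> polys R d k q -> polys R d k (m - q).
Proof.
move=> mk /polys_opp qk; apply: leq_trans (mpoly.msizeD_le _ _) _.
by rewrite geq_max mk.
Qed.

Lemma pevalB {R : realType} {d : nat} (m q : mpoly.mpoly d R) (x : 'rV[R]_d) :
  peval (m - q) x = peval m x - peval q x.
Proof. exact: mpoly.mevalB. Qed.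

Lemma peval_sum_mcoeff {R : realType} {d k : nat} {m : mpoly.mpoly d R}
    (x : 'rV[R]_d) : polys R d k m ->
  peval m x = \sum_(a : mpoly.bmultinom d k)
                mpoly.mcoeff (mpoly.bmnm a) m * \prod_i x ord0 i ^+ mpoly.bmnm a i.
Proof.
move=> mk; rewrite /peval {1}(mpoly.mpolywE mk) raddf_sum /=.
by apply: eq_bigr => a _; rewrite mpoly.mevalZ mpoly.mevalX.
Qed.

(** The weight [w j a] is the coefficient of degree [a] of the [j]-th Lagrange
    polynomial: interpolating the monomial of degree [b] reproduces it. *)
Lemma coef_extraction_weights {R : fieldType} (k : nat) {t : nat -> R} :
  injective t -> exists w : 'I_k -> nat -> R, forall a b, (b < k)%N ->
    \sum_(j < k) w j a * t j ^+ b = (b == a)%:R.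
Proof.
move=> t_inj; exists (fun j a => (tnth (qpoly.lagrange k t) j : {poly R})`_a).
move=> a b bk.
have k_gt0 : (0 < k)%N by apply: leq_ltn_trans bk.
have sb : (size ('X^b : {poly R})%R <= k)%N by rewrite size_polyXn.
have := congr1 (fun q : {poly R} => q`_a) (qpoly.lagrange_gen k_gt0 t_inj sb).
rewrite coefXn coef_sum eq_sym => ->.
by apply: eq_bigr => j _; rewrite coefCM hornerXn mulrC.
Qed.

(** Interpolation on a tensor grid of [k ^ d] points of [Q] writes each
    coefficient of a polynomial of degree less than [k] as a fixed linear
    combination of its values at these points; the weights are products of
    one-dimensional ones. *)
Lemma mcoeff_le_sup_cube {R : realType} {d k : nat} {Q : set 'rV[R]_d} :
  is_cube Q -> exists2 K : R, 0 <= K & forall (m : mpoly.mpoly d R) (B : R),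
    polys R d k m -> (forall x, Q x -> `|peval m x| <= B) ->
    forall a : mpoly.bmultinom d k, `|mpoly.mcoeff (mpoly.bmnm a) m| <= K * B.
Proof.
move=> [a0 [s [s_gt0 QE]]].
pose t (i : 'I_d) (j : nat) : R := a0 ord0 i + s * (j%:R / k%:R).
have [k0|k_gt0] := posnP k.
  exists 0 => // m B _ _ a.
  by have := leq_trans (mpoly.bmdeg a) (eq_leq k0).
have kn0 : k%:R != 0 :> R by rewrite pnatr_eq0 -lt0n.
have t_inj i : injective (t i).
  move=> j j' /addrI /(mulfI (lt0r_neq0 s_gt0)) /(mulIf (invr_neq0 kn0)).
  exact: mulrIn.
have [w wE] : exists w : 'I_d -> 'I_k -> nat -> R, forall i a b, (b < k)%N ->
    \sum_(j < k) w i j a * t i j ^+ b = (b == a)%:R.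
  have /choice[w wE] i := coef_extraction_weights k (t_inj i).
  by exists w.
pose y (c : {ffun 'I_d -> 'I_k}) : 'rV[R]_d := \row_i t i (c i).
have Qy c : Q (y c).
  rewrite QE; exists (\row_i ((c i)%:R / k%:R)).
    move=> i; rewrite mxE divr_ge0 ?ler0n //=.
    by rewrite ler_pdivrMr ?ltr0n // mul1r ler_nat ltnW.
  by apply/rowP => i; rewrite !mxE.
pose W (a : mpoly.bmultinom d k) (c : {ffun 'I_d -> 'I_k}) :=
  \prod_i w i (c i) (mpoly.bmnm a i).
have coefE m (a : mpoly.bmultinom d k) : polys R d k m ->
    mpoly.mcoeff (mpoly.bmnm a) m = \sum_c W a c * peval m (y c).
  move=> mk.
  under eq_bigr => c _ do rewrite (peval_sum_mcoeff _ mk) mulr_sumr.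
  rewrite exchange_big /=.
  (* The sum over the grid factors into one sum for each coordinate. *)
  under eq_bigr => b _.
    under eq_bigr => c _.
      rewrite mulrCA /W -big_split /=.
      under eq_bigr => i _ do rewrite mxE.
      over.
    rewrite -mulr_sumr.
    rewrite -(bigA_distr_bigA (fun i j => w i j (mpoly.bmnm a i) * t i j ^+ mpoly.bmnm b i)) /=.
    under eq_bigr => i _.
      rewrite wE; last first.
        apply: leq_ltn_trans (mpoly.bmdeg b).
        by rewrite mpoly.mdegE (bigD1 i) //= leq_addr.
      over.
    over.
  rewrite (bigD1 a) //= [X in _ * X]big1 ?mulr1; last by move=> i _; rewrite eqxx.
  rewrite big1 ?addr0 // => b ba.
  have [i bai] : exists i, mpoly.bmnm b i != mpoly.bmnm a i.
    apply/existsP; apply: contraR ba => /existsPn h.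
    rewrite mpoly.bmeqP; apply/eqP/mpoly.mnmP => i.
    by apply/eqP; have := h i; rewrite negbK.
  by rewrite (bigD1 i) //= (negbTE bai) mul0r mulr0.
(* A sum over all [a], so that one constant serves every coefficient. *)
exists (\sum_a \sum_c `|W a c|).
  by apply: sumr_ge0 => a _; apply: sumr_ge0.
move=> m B mk mB a; rewrite (coefE m a mk).
have B0 : 0 <= B by apply: le_trans (mB _ (Qy [ffun=> Ordinal k_gt0])).
apply: le_trans (ler_norm_sum _ _ _) _.
apply: (@le_trans _ _ ((\sum_c `|W a c|) * B)).
  by rewrite mulr_suml; apply: ler_sum => c _; rewrite normrM ler_wpM2l // mB.
rewrite ler_wpM2r // [leRHS](bigD1 a) //= lerDl.
by apply: sumr_ge0 => b _; apply: sumr_ge0.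
Qed.

(** * Limits along an ultrafilter *)

Lemma ultra_pushforward {T V : Type} (u : T -> V) (U : set_system T) :
  UltraFilter U -> UltraFilter (u @ U).
Proof.
move=> UU; split; first exact: fmap_proper_filter.
move=> G GF sUG; apply/seteqP; split => // A GA.
have [//|UnA] := in_ultra_setVsetC (u @^-1` A) UU.
have GnA : G (~` A) by apply: sUG.
by have /filter_ex[? []] : G (A `&` ~` A) by exact: filterI.
Qed.

Lemma bounded_ultra_cvg {R : realType} {T : Type} {U : set_system T}
    (u : T -> R) (B : R) :
  UltraFilter U -> (forall n, `|u n| <= B) -> exists l : R, u @ U --> l.
Proof.
move=> UU uB.
have UB : (u @ U) `[- B, B]%classic.
  have : U (u @^-1` `[- B, B]%classic) by apply: filterE => n; rewrite /= in_itv /= -ler_norml.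
  exact.
have := @segment_compact R (- B) B; rewrite compact_ultra.
by move=> /(_ (u @ U) (ultra_pushforward u U UU) UB)[l [_ ul]]; exists l.
Qed.

(** Compactness of bounded sets of polynomials, in the form of limits along an
    ultrafilter: the coefficients are bounded real sequences, and convergence
    of the coefficients is uniform on the unit cube, where monomials are at
    most 1 in absolute value. *)
Lemma ultra_limit_polys {R : realType} {d k : nat} {Q : set 'rV[R]_d}
    {U : set_system nat} (m : nat -> mpoly.mpoly d R) (B : R) :
  UltraFilter U -> is_cube Q -> (forall n, polys R d k (m n)) ->
  (forall n x, Q x -> `|peval (m n) x| <= B) ->
  exists2 q, polys R d k q & forall e, 0 < e ->
    U [set n | forall x, unit_cube R d x -> `|peval (m n) x - peval q x| <= e].
Proof.
move=> UU Qcube mk mB; have [K K0 KB] := mcoeff_le_sup_cube (k := k) Qcube.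
have /choice[l lE] (a : mpoly.bmultinom d k) : exists l : R,
    mpoly.mcoeff (mpoly.bmnm a) (m n) @[n --> U] --> l.
  by apply: (bounded_ultra_cvg _ (K * B)) => n; apply: KB => // x; apply: mB.
pose q : mpoly.mpoly d R :=
  \sum_(a : mpoly.bmultinom d k) l a *: mpoly.mpolyX R (mpoly.bmnm a).
have qk : polys R d k q.
  rewrite /polys /=; apply: leq_trans (mpoly.msize_sum _ _ _) _.
  apply/bigmax_leqP => a _; apply: leq_trans (mpoly.msizeZ_le _ _) _.
  by rewrite mpoly.msizeX mpoly.bmdeg.
have qE a : mpoly.mcoeff (mpoly.bmnm a) q = l a.
  rewrite raddf_sum /= (bigD1 a) //= mpoly.mcoeffZ mpoly.mcoeffX eqxx mulr1.
  rewrite big1 ?addr0 // => b ba.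
  by rewrite mpoly.mcoeffZ mpoly.mcoeffX -mpoly.bmeqP (negbTE ba) mulr0.
exists q => // e e0; pose N := #|{: mpoly.bmultinom d k}|.
have N0 : 0 < N%:R + 1 :> R by rewrite ltr_wpDl.
have eN : 0 < e / (N%:R + 1) by rewrite divr_gt0.
have : \forall n \near U, forall a : mpoly.bmultinom d k,
    `|l a - mpoly.mcoeff (mpoly.bmnm a) (m n)| <= e / (N%:R + 1).
  by apply: filter_forall => a; move/cvgrPdist_le : (lE a); apply.
apply: filterS => n /= ln x x01.
rewrite distrC -pevalB (peval_sum_mcoeff x (polys_sub qk (mk n))).
apply: le_trans (ler_norm_sum _ _ _) _.
apply: (@le_trans _ _ (\sum_(a : mpoly.bmultinom d k) e / (N%:R + 1))).
  apply: ler_sum => a _; rewrite normrM -[leRHS]mulr1 ler_pM //.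
    by rewrite mpoly.mcoeffB qE ln.
  rewrite normr_prod; apply: prodr_ile1 => i _; rewrite normr_ge0 normrX /=.
  have /andP[x0 x1] := x01 i.
  by rewrite exprn_ile1 // ger0_norm.
rewrite sumr_const -/N -(mulr_natr (e / _)) mulrAC ler_pdivrMr //.
by rewrite ler_wpM2l ?(ltW e0) // lerDl.
Qed.

(** * Local polynomial approximation *)

Lemma is_cube_nonempty {R : realType} {d : nat} {Q : set 'rV[R]_d} :
  is_cube Q -> Q !=set0.
Proof.
move=> [a [s [s0 ->]]]; exists (a + s *: 0); exists 0 => // i.
by rewrite mxE lexx ler01.
Qed.

Lemma Ek_le {R : realType} {d k : nat} {f : 'rV[R]_d -> R} {Q : set 'rV[R]_d}
    {m : mpoly.mpoly d R} {c : R} :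
  polys R d k m -> (forall x, Q x -> `|f x - peval m x| <= c) ->
  (Ek k f Q <= c%:E)%E.
Proof.
move=> mk fm.
apply: (@le_trans _ _ (ereal_sup [set `|f x - peval m x|%:E | x in Q])).
  by apply: ereal_inf_lbound; exists m.
by apply: ge_ereal_sup => _ [x Qx <-]; rewrite lee_fin fm.
Qed.

Lemma Ek_lt {R : realType} {d k : nat} {f : 'rV[R]_d -> R} {Q : set 'rV[R]_d}
    {c : R} :
  (Ek k f Q < c%:E)%E ->
  exists2 m, polys R d k m & forall x, Q x -> `|f x - peval m x| <= c.
Proof.
move=> /ereal_inf_lt[_ [m mk <-]] fm; exists m => // x Qx.
rewrite -lee_fin; apply: le_trans (ltW fm).
by apply: ereal_sup_ubound; exists x.
Qed.

Lemma Ek_ge0 {R : realType} {d k : nat} {f : 'rV[R]_d -> R}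
    {Q : set 'rV[R]_d} : is_cube Q -> (0 <= Ek k f Q)%E.
Proof.
move=> /is_cube_nonempty[x Qx]; apply: le_ereal_inf_tmp => _ [m mk <-].
apply: (@le_trans _ _ (`|f x - peval m x|%:E)); first by rewrite lee_fin.
by apply: ereal_sup_ubound; exists x.
Qed.

Lemma Ek_fin_num {R : realType} {d k : nat} {f : 'rV[R]_d -> R}
    {Q : set 'rV[R]_d} {B : R} :
  is_cube Q -> (forall x, Q x -> `|f x| <= B) -> Ek k f Q \is a fin_num.
Proof.
move=> Qcube fB; rewrite ge0_fin_numE ?Ek_ge0 //.
have zk : polys R d k 0 by rewrite /polys /= mpoly.msize0.
apply: le_lt_trans (ltry B); apply: (Ek_le zk) => x Qx.
by rewrite /peval mpoly.meval0 subr0 fB.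
Qed.

Lemma EkD_polys {R : realType} {d k : nat} (f : 'rV[R]_d -> R)
    {q : mpoly.mpoly d R} (Q : set 'rV[R]_d) : polys R d k q ->
  Ek k (fun x => f x + peval q x) Q = Ek k f Q.
Proof.
move=> qk; suff Ele (g : 'rV[R]_d -> R) (r : mpoly.mpoly d R) : polys R d k r ->
    (Ek k (fun x => (g x + peval r x)%R) Q <= Ek k g Q)%E.
  apply/eqP; rewrite eq_le Ele //=.
  have {1}-> : f = (fun x => f x + peval q x + peval (- q) x).
    by apply/funext => x; rewrite /peval mpoly.mevalN addrK.
  exact: (Ele (fun x => f x + peval q x) (- q) (polys_opp qk)).
move=> rk; apply: le_ereal_inf_tmp => _ [m mk <-].
have mrk : polys R d k (m - (- r)) := polys_sub mk (polys_opp rk).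
apply: (@le_trans _ _ (ereal_sup
    [set `|g x + peval r x - peval (m - (- r)) x|%:E | x in Q])).
  by apply: ereal_inf_lbound; exists (m - (- r)).
rewrite opprK; apply: le_ereal_sup => _ [x Qx <-]; exists x => //.
by rewrite /peval mpoly.mevalD opprD addrACA subrr addr0.
Qed.

Lemma Vseminorm_addpolys {R : realType} {d k : nat} (p : R) (f : 'rV[R]_d -> R)
    {q : mpoly.mpoly d R} : polys R d k q ->
  Vseminorm k p (fun x => f x + peval q x) = Vseminorm k p f.
Proof.
move=> qk; congr ereal_sup; apply: eq_imagel => pi _.
by congr (_ `^ _)%E; apply: eq_fsbigr => Q _; rewrite EkD_polys.
Qed.

(** A single polynomial approximates [U]-many of the [g n] almost as well as
    the best polynomials do: it is the limit along [U] of near-optimal ones. *)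
Lemma Ek_ultra_limit {R : realType} {d k : nat} {Q : set 'rV[R]_d}
    {U : set_system nat} (g : nat -> 'rV[R]_d -> R) {B e eta : R} :
  UltraFilter U -> is_cube Q -> Q `<=` unit_cube R d ->
  (forall n x, unit_cube R d x -> `|g n x| <= B) -> 0 < eta ->
  U [set n | (Ek k (g n) Q <= e%:E)%E] ->
  exists2 q, polys R d k q &
    U [set n | forall x, Q x -> `|g n x - peval q x| <= e + eta].
Proof.
move=> UU Qcube Q01 gB eta0 UE.
have eta2 : 0 < eta / 2 by rewrite divr_gt0.
(* Outside the given member of [U], the zero polynomial keeps the bound. *)
have /choice[m mE] n : exists m, [/\ polys R d k m,
    (Ek k (g n) Q <= e%:E)%E ->
      forall x, Q x -> `|g n x - peval m x| <= e + eta / 2 &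
    forall x, Q x -> `|peval m x| <= `|e| + eta / 2 + B].
  have [Ee|nEe] := pselect (Ek k (g n) Q <= e%:E)%E; last first.
    exists 0; split => // [|x Qx]; first by rewrite /polys /= mpoly.msize0.
    rewrite /peval mpoly.meval0 normr0 !addr_ge0 ?(ltW eta2) //.
    exact: le_trans (normr_ge0 _) (gB n x (Q01 x Qx)).
  have /Ek_lt[m mk gm] : (Ek k (g n) Q < (e + eta / 2)%:E)%E.
    by apply: le_lt_trans Ee _; rewrite lte_fin ltrDl.
  exists m; split => // x Qx.
  rewrite -[peval _ _](subKr (g n x)) (le_trans (ler_normB _ _)) //.
  by rewrite addrC lerD ?gB ?(le_trans (gm x Qx)) ?lerD2r ?ler_norm //; apply: Q01.
have [||q qk qE] := ultra_limit_polys (k := k) m (`|e| + eta / 2 + B) UU Qcube.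
- by move=> n; have [] := mE n.
- by move=> n; have [] := mE n.
exists q => //; apply: filterS (filterI UE (qE _ eta2)) => n [/= Ee mq] x Qx.
have [_ /(_ Ee x Qx) gm _] := mE n.
rewrite -(subrK (peval (m n) x) (g n x)) -addrA (le_trans (ler_normD _ _)) //.
have := mq x (Q01 x Qx); lra.
Qed.

(** * Grids of the unit cube *)

Definition grid_cell (R : realType) (d j : nat) (c : {ffun 'I_d -> 'I_j.+1}) :
    set 'rV[R]_d :=
  [set x | forall i, (c i)%:R / j.+1%:R <= x ord0 i <= (c i).+1%:R / j.+1%:R].
Arguments grid_cell R {d j} c.

Lemma grid_cell_cube {R : realType} {d j : nat} (c : {ffun 'I_d -> 'I_j.+1}) :
  is_cube (grid_cell R c).
Proof.
have N0 : 0 < j.+1%:R :> R by rewrite ltr0n.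
exists (\row_i ((c i)%:R / j.+1%:R)), j.+1%:R^-1.
split; first by rewrite invr_gt0.
apply/seteqP; split => [x xc|_ [y y01 <-] i]; last first.
  have /andP[y0 y1] := y01 i; rewrite !mxE lerDl mulr_ge0 ?invr_ge0 ?(ltW N0) //=.
  by rewrite -[(c i).+1%:R]natr1 mulrDl lerD2l mulrC ler_pM2r // invr_gt0.
exists (j.+1%:R *: (x - \row_i ((c i)%:R / j.+1%:R))).
  move=> i; have := xc i; rewrite !mxE -[(c i).+1%:R]natr1 mulrDl div1r => /andP[h1 h2].
  rewrite mulr_ge0 ?subr_ge0 ?(ltW N0) //= mulrC -ler_pdivlMr // div1r.
  by rewrite lerBlDl.
by rewrite scalerA mulVf ?gt_eqF // scale1r addrC subrK.
Qed.

Lemma grid_cell_sub {R : realType} {d j : nat} (c : {ffun 'I_d -> 'I_j.+1}) :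
  grid_cell R c `<=` unit_cube R d.
Proof.
move=> x xc i; have /andP[h1 h2] := xc i.
rewrite (le_trans _ h1) ?divr_ge0 //= (le_trans h2) //.
by rewrite ler_pdivrMr ?ltr0n // mul1r ler_nat.
Qed.

Lemma grid_cell_cover {R : realType} {d : nat} (j : nat) {x : 'rV[R]_d} :
  unit_cube R d x -> exists c : {ffun 'I_d -> 'I_j.+1}, grid_cell R c x.
Proof.
move=> x01; suff /choice[c cE] i : exists c : 'I_j.+1,
    c%:R / j.+1%:R <= x ord0 i <= c.+1%:R / j.+1%:R.
  by exists [ffun i => c i] => i; rewrite ffunE.
have /andP[x0 x1] := x01 i.
have N0 : 0 < j.+1%:R :> R by rewrite ltr0n.
have y0 : 0 <= j.+1%:R * x ord0 i by rewrite mulr_ge0 // ltW.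
have /andP[t0 t1] := truncn_itv y0.
have tj : (minn (Num.truncn (j.+1%:R * x ord0 i)) j < j.+1)%N.
  by rewrite ltnS geq_minr.
exists (Ordinal tj) => /=.
rewrite ler_pdivrMr // ler_pdivlMr // [x _ _ * _]mulrC.
case: leqP => h; first by rewrite t0 ltW.
rewrite (le_trans _ t0) ?ler_nat 1?ltnW //=.
by rewrite ler_piMr // ltW.
Qed.

Lemma grid_cell_dist {R : realType} {d j : nat} {c : {ffun 'I_d -> 'I_j.+1}}
    {x y : 'rV[R]_d} (i : 'I_d) : grid_cell R c x -> grid_cell R c y ->
  `|x ord0 i - y ord0 i| <= j.+1%:R^-1.
Proof.
move=> /(_ i)/andP[x0 x1] /(_ i)/andP[y0 y1].
move: x0 x1 y0 y1; rewrite -[(c i).+1%:R]natr1 mulrDl mul1r ler_norml.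
by move: (j.+1%:R^-1) ((c i)%:R / _) => v u *; apply/andP; split; lra.
Qed.

(** Moving an interior point a little along the diagonal keeps it in the cell. *)
Lemma interior_grid_cell_lt {R : realType} {d j : nat}
    {c : {ffun 'I_d -> 'I_j.+1}} {x : 'rV[R]_d} (i : 'I_d) :
  (grid_cell R c)° x -> x ord0 i < (c i).+1%:R / j.+1%:R.
Proof.
move=> /nbhs_ballP[e /= e0 xe].
have /xe/(_ i)/andP[_] : ball x e (x + const_mx (e / 2)).
  split=> // i' j'; rewrite !mxE /ball /= opprD addrA subrr add0r normrN.
  by rewrite gtr0_norm ?divr_gt0 // ltr_pdivrMr // ltr_pMr // ltr1n.
by rewrite !mxE; apply: lt_le_trans; rewrite ltrDl divr_gt0.
Qed.

Lemma grid_cell_disjoint {R : realType} {d j : nat}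
    {c c' : {ffun 'I_d -> 'I_j.+1}} :
  (grid_cell R c)° `&` (grid_cell R c')° !=set0 -> c = c'.
Proof.
move=> [x [xc xc']]; apply/ffunP => i; apply: val_inj => /=.
have N0 : 0 < j.+1%:R^-1 :> R by rewrite invr_gt0 ltr0n.
have half (b b' : {ffun 'I_d -> 'I_j.+1}) : (grid_cell R b)° x ->
    (grid_cell R b')° x -> (b i <= b' i)%N.
  move=> /interior_subset/(_ i)/andP[h _] /(interior_grid_cell_lt i) h'.
  by have := le_lt_trans h h'; rewrite ltr_pM2r // ltr_nat.
by apply/eqP; rewrite eqn_leq !half.
Qed.

(** * Finiteness of the set of oscillation points *)

(** The seminorm bound without the outer power, which is the form used for
    counting cells. *)
Lemma packing_sum_le {R : realType} {d k : nat} {p C : R} {f : 'rV[R]_d -> R}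
    {pk : set (set 'rV[R]_d)} :
  0 < p -> finite_packings R d pk -> (Vseminorm k p f <= C%:E)%E ->
  (\sum_(Q \in pk) Ek k f Q `^ p <= (C `^ p)%:E)%E.
Proof.
move=> p0 pack fC; set S := (X in (X <= _)%E).
have S0 : (0 <= S)%E by apply: fsume_ge0 => Q _; exact: poweR_ge0.
have SC : (S `^ p^-1 <= C%:E)%E.
  by apply: le_trans fC; apply: ereal_sup_ubound; exists pk.
have -> : S = ((S `^ p^-1) `^ p)%E.
  by rewrite -poweRrM mulVf ?gt_eqF // poweRe1.
rewrite -poweR_EFin; apply: gt0_ler_poweR => //; first exact: ltW.
- by rewrite in_itv /= poweR_ge0 leey.
- by rewrite in_itv /= leey andbT (le_trans _ SC) // poweR_ge0.
Qed.

Lemma Ek_le_Vseminorm {R : realType} {d k : nat} {p : R} {f : 'rV[R]_d -> R}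
    {Q : set 'rV[R]_d} : 0 < p -> is_cube Q -> Q `<=` unit_cube R d ->
  (Ek k f Q <= Vseminorm k p f)%E.
Proof.
move=> p0 Qcube Q01; apply: ereal_sup_ubound; exists [set Q].
  split; [exact: finite_set1| split |by move=> _ ->].
  - by move=> _ ->.
  - by move=> A B -> ->.
by rewrite fsbig_set1 -poweRrM mulfV ?gt_eqF // poweRe1 ?Ek_ge0.
Qed.

(** The points at which [g] may oscillate by more than [e] along [U] at every
    scale. *)
Definition bad_points {R : realType} {d : nat} (k : nat) (U : set_system nat)
    (g : nat -> 'rV[R]_d -> R) (e : R) : set 'rV[R]_d :=
  [set x | unit_cube R d x /\
    forall j (c : {ffun 'I_d -> 'I_j.+1}), grid_cell R c x ->
      ~ U [set n | (Ek k (g n) (grid_cell R c) <= e%:E)%E]].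

(** Finitely many distinct points differ in some coordinate by more than the
    side of a fine enough grid. *)
Lemma grid_separates {R : realType} {d : nat} (B : {fset 'rV[R]_d}) :
  exists j, forall (c : {ffun 'I_d -> 'I_j.+1}) x y, x \in B -> y \in B ->
    grid_cell R c x -> grid_cell R c y -> x = y.
Proof.
have : \forall j \near \oo, forall z, z \in (B `*` B)%fset -> z.1 != z.2 ->
    exists i, j.+1%:R^-1 < `|z.1 ord0 i - z.2 ord0 i|.
  apply: (@filter_bigI _ _ (B `*` B)%fset (fun z j => z.1 != z.2 ->
    exists i, j.+1%:R^-1 < `|z.1 ord0 i - z.2 ord0 i|)) => -[x y] _ /=.
  have [<-|xy] := eqVneq x y; first by apply: (@filterE _ eventually) => j; rewrite ?eqxx.
  have [i xyi] : exists i, x ord0 i != y ord0 i.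
    apply/existsP; apply: contraR xy => /existsPn h.
    by apply/eqP/rowP => i; apply/eqP; have := h i; rewrite negbK.
  have e0 : 0 < `|x ord0 i - y ord0 i| by rewrite normr_gt0 subr_eq0.
  by apply: filterS (near_infty_natSinv_lt (PosNum e0)) => j /= ?; exists i.
move=> /filter_ex[j jB]; exists j => c x y xB yB xc yc.
apply/eqP/negPn/negP => xy.
have [||i] := jB (x, y); [by rewrite in_fsetM /= xB|by []|].
by rewrite ltNge (grid_cell_dist i xc yc).
Qed.

(** Put [N] bad points into distinct cells of a fine grid.  For [U]-many [n]
    the function [g n] has [Ek] at least [e] on all these cells, so the packing
    they form gives [N * e ^ p <= C ^ p]. *)
Lemma finite_bad_points {R : realType} {d k : nat} {U : set_system nat}
    {p C e : R} (g : nat -> 'rV[R]_d -> R) :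
  UltraFilter U -> 0 < p -> 0 < e ->
  (forall n, (Vseminorm k p (g n) <= C%:E)%E) ->
  finite_set (bad_points k U g e).
Proof.
move=> UU p0 e0 gC; apply: contrapT => infbad.
have ep : 0 < e `^ p by rewrite powR_gt0.
(* One more than the largest number of points that the packing allows. *)
pose N := (Num.truncn (C `^ p / e `^ p)).+1.
have [B Bbad NB] := infinite_set_fset N infbad.
have [j jB] := grid_separates B.
have /choice[c cE] x : exists c : {ffun 'I_d -> 'I_j.+1},
    unit_cube R d x -> grid_cell R c x.
  have [/(grid_cell_cover j)[c xc]|x01] := pselect (unit_cube R d x).
    by exists c.
  (* An arbitrary cell, to make the choice total. *)
  by exists [ffun=> ord0].
have {}cE x : x \in B -> grid_cell R (c x) x.
  by move=> xB; apply: cE; have [] := Bbad x xB.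
have : \forall n \near U, forall x, x \in B ->
    (e%:E <= Ek k (g n) (grid_cell R (c x)))%E.
  apply: (@filter_bigI _ _ B (fun x n =>
    (e%:E <= Ek k (g n) (grid_cell R (c x)))%E)) => x xB.
  have [_ /(_ j (c x) (cE x xB)) nU] := Bbad x xB.
  have [//|] := in_ultra_setVsetC
    [set n | (Ek k (g n) (grid_cell R (c x)) <= e%:E)%E] UU.
  by apply: filterS => n /= /negP; rewrite -ltNge => /ltW.
move=> /filter_ex[n nB].
have pack : finite_packings R d [set grid_cell R (c x) | x in [set` B]].
  split; first exact: finite_image.
    split=> [_ [x _ <-]|_ _ [x _ <-] [y _ <-] /grid_cell_disjoint-> //].
    exact: grid_cell_cube.
  by move=> _ [x _ <-]; exact: grid_cell_sub.
have := packing_sum_le p0 pack (gC n); apply/negP; rewrite -ltNge.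
rewrite fsbig_image; last first.
  move=> x y /set_mem xB /set_mem yB cxy.
  by apply: (jB (c x)) => //; [exact: cE|rewrite cxy; exact: cE].
apply: (@lt_le_trans _ _ (\sum_(x \in [set` B]) (e `^ p)%:E)%E); last first.
  apply: lee_fsum => // x xB; rewrite -poweR_EFin gt0_ler_poweR ?(ltW p0) //.
  - by rewrite in_itv /= lee_fin ltW // leey.
  - by rewrite in_itv /= leey Ek_ge0 //; exact: grid_cell_cube.
  - exact: nB.
rewrite -fsbig_seq ?fset_uniq // sumEFin lte_fin big_const_seq count_predT.
rewrite iter_addr addr0 -mulr_natr mulrC -ltr_pdivrMr //.
apply: lt_le_trans (_ : N%:R <= _); last by rewrite ler_nat.
by rewrite /N; apply: truncnS_gt.
Qed.

(** * Lower semicontinuity *)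

Lemma cvg_norm_le {R : realType} {T : Type} {F : set_system T}
    {u : T -> R} {l B : R} :
  ProperFilter F -> u @ F --> l -> (forall n, `|u n| <= B) -> `|l| <= B.
Proof.
move=> FF ul uB; apply/ler_addgt0Pr => e e0.
move/cvgrPdist_le : ul => /(_ e e0)/filter_ex[n lun].
by rewrite -(subrK (u n) l) (le_trans (ler_normD _ _)) // addrC lerD.
Qed.

(** Otherwise [F] has a finer ultrafilter along which [Ek k (g n) Q <= c]; a
    polynomial close to the [g n] along it is as close to their limit [h]. *)
Lemma Ek_lower_semicontinuous {R : realType} {d k : nat} {Q : set 'rV[R]_d}
    {F : set_system nat} {g : nat -> 'rV[R]_d -> R} {h : 'rV[R]_d -> R}
    {B c : R} :
  ProperFilter F -> is_cube Q -> Q `<=` unit_cube R d ->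
  (forall n x, unit_cube R d x -> `|g n x| <= B) ->
  (forall x, unit_cube R d x -> g n x @[n --> F] --> h x) ->
  (c%:E < Ek k h Q)%E -> \forall n \near F, (c%:E < Ek k (g n) Q)%E.
Proof.
move=> FF Qcube Q01 gB gh cE; apply: contrapT => nF.
pose A := [set n | (Ek k (g n) Q <= c%:E)%E].
have AF : ProperFilter (within A F).
  split; last exact: within_filter.
  move=> F0; apply: nF; have {F0}: F (fun n => A n -> set0 n) := F0.
  by apply: filterS => n An; rewrite ltNge; apply/negP.
have [U [UU FU]] := ultraFilterLemma AF.
have UA : U A by apply: FU; exact: withinT.
have Ugh x : unit_cube R d x -> g n x @[n --> U] --> h x.
  move=> x01; apply: cvg_trans (gh x x01); apply: cvg_app.
  exact: cvg_trans FU (cvg_within _).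
suff : (Ek k h Q <= c%:E)%E by rewrite leNgt cE.
apply/lee_addgt0Pr => e e0; rewrite -EFinD.
have e2 : 0 < e / 2 by rewrite divr_gt0.
have [q qk qE] := Ek_ultra_limit g UU Qcube Q01 gB e2 UA.
apply: (Ek_le qk) => x Qx.
move/cvgrPdist_le : (Ugh x (Q01 x Qx)) => /(_ _ e2) hx.
have [n [/= /(_ x Qx) gq hg]] := filter_ex (filterI qE hx).
rewrite -(subrK (g n x) (h x)) -addrA (le_trans (ler_normD _ _)) //.
lra.
Qed.

(** For one packing and [t < 1], the strict inequality [t * Ek k h Q < Ek k h Q]
    on its finitely many cubes passes to [g n] for all [n] far along [F]; by
    homogeneity the whole sum is then only multiplied by [t]. *)
Lemma Vseminorm_lower_semicontinuous {R : realType} {d k : nat} {p : R}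
    {F : set_system nat} {g : nat -> 'rV[R]_d -> R} {h : 'rV[R]_d -> R}
    {B : R} :
  ProperFilter F -> 0 < p ->
  (forall n x, unit_cube R d x -> `|g n x| <= B) ->
  (forall x, unit_cube R d x -> g n x @[n --> F] --> h x) ->
  (Vseminorm k p h <= limf_einf (fun n => Vseminorm k p (g n)) F)%E.
Proof.
move=> FF p0 gB gh; apply: ge_ereal_sup => _ [pk pack <-].
have [finpi [cubes _] pi01] := pack.
apply/lee_mul01Pr; first exact: poweR_ge0.
move=> t /andP[t0 t1].
have : \forall n \near F, forall Q, Q \in fset_set pk ->
    (t%:E * Ek k h Q <= Ek k (g n) Q)%E.
  apply: (@filter_bigI _ _ (fset_set pk) (fun Q n =>
    (t%:E * Ek k h Q <= Ek k (g n) Q)%E)) => Q.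
  rewrite in_fset_set // => /set_mem piQ.
  have Qcube := cubes Q piQ; have Q01 := pi01 Q piQ.
  have hB x : Q x -> `|h x| <= B.
    by move=> Qx; apply: (cvg_norm_le FF (gh x (Q01 x Qx))) => n; apply/gB/Q01.
  have hfin : Ek k h Q \is a fin_num := Ek_fin_num Qcube hB.
  (* The strict inequality needs a positive error; a zero one is trivial. *)
  have := Ek_ge0 (k := k) (f := h) Qcube; rewrite le_eqVlt => /predU1P[<-|h0].
    by apply: nearW => n; rewrite mule0 Ek_ge0.
  have : ((t * fine (Ek k h Q))%:E < Ek k h Q)%E.
    rewrite -[ltRHS]fineK // lte_fin gtr_pMl // -lte_fin fineK //.
  move=> /(Ek_lower_semicontinuous FF Qcube Q01 gB gh).
  by apply: filterS => n /ltW; rewrite EFinM fineK.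
move=> nearF; rewrite limf_einfE.
apply: le_ereal_sup_tmp; exists (ereal_inf [set Vseminorm k p (g n) | n in
    [set n | forall Q, Q \in fset_set pk ->
      (t%:E * Ek k h Q <= Ek k (g n) Q)%E]]); first by eexists; first exact: nearF.
apply: le_ereal_inf_tmp => _ [n tn <-].
apply: (@le_trans _ _ ((\sum_(Q \in pk) Ek k (g n) Q `^ p) `^ p^-1)%E); last first.
  by apply: ereal_sup_ubound; exists pk.
have -> : t%:E = ((t%:E `^ p) `^ p^-1)%E.
  by rewrite -poweRrM mulfV ?gt_eqF // poweRe1 // lee_fin ltW.
have sum0 f' : (0 <= \sum_(Q \in pk) Ek k f' Q `^ p)%E.
  by apply: fsume_ge0 => Q _; exact: poweR_ge0.
rewrite -poweRM ?poweR_ge0 //.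
have le_sum : (t%:E `^ p * \sum_(Q \in pk) Ek k h Q `^ p <=
    \sum_(Q \in pk) Ek k (g n) Q `^ p)%E.
  rewrite ge0_mule_fsumr; last by move=> Q; exact: poweR_ge0.
  apply: lee_fsum => // Q piQ; have Qcube := cubes Q piQ.
  have tE0 : (0 <= t%:E * Ek k h Q)%E by rewrite mule_ge0 ?Ek_ge0 ?lee_fin ?ltW.
  rewrite -poweRM ?Ek_ge0 ?lee_fin ?(ltW t0) //.
  apply: gt0_ler_poweR; rewrite ?(ltW p0) // ?in_itv /= ?leey ?andbT ?Ek_ge0 //.
  by apply: tn; rewrite in_fset_set //; exact: mem_set.
apply: gt0_ler_poweR => //; first by rewrite invr_ge0 ltW.
- rewrite in_itv /= leey andbT; apply: mule_ge0; last exact: sum0.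
  by rewrite lee_fin powR_ge0.
- by rewrite in_itv /= leey andbT; exact: sum0.
Qed.

(** * Extraction of a pointwise convergent subsequence *)

Lemma infinite_within_proper {J : set nat} :
  infinite_set J -> ProperFilter (within J \oo).
Proof.
move=> Jinf; split; last exact: within_filter.
move=> [N _ NJ]; apply: Jinf; apply: (sub_finite_set _ (finite_II N)) => n Jn.
by rewrite /= ltnNge; apply/negP => Nn; exact: (NJ n Nn Jn).
Qed.

(** Choose [s n >= n] in the intersection of the first [n + 1] sets: finite
    intersections belong to [U], hence are unbounded, and the range of [s]
    leaves each set [A i] only at indices below the rank of [i]. *)
Lemma pseudo_intersection {I : countType} {U : set_system nat}
    (A : I -> set nat) :
  ProperFilter U -> \oo `<=` U -> (forall i, U (A i)) ->
  exists2 J, infinite_set J & forall i, within J \oo (A i).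
Proof.
move=> UU ooU UA.
have /choice[s sE] n : exists m, (n <= m)%N /\
    forall i : I, (choice.pickle i <= n)%N -> A i m.
  have Un : U [set m | (n <= m)%N] by apply: ooU; exact: nbhs_infty_ge.
  have : \forall m \near U, forall j : 'I_n.+1,
      oapp A setT (choice.unpickle j) m.
    by apply: filter_forall => j; case: choice.unpickle => [i|] /=; [|exact: filterT].
  move=> /(filterI Un)/filter_ex[m [nm mA]]; exists m; split=> // i i_n.
  by have := mA (Ordinal (leq_ltn_trans i_n (ltnSn n))); rewrite /= choice.pickleK.
exists (range s).
  move=> /finite_seqP[r rE].
  have /[!rE] /= sr : range s (s (\max_(i <- r) i).+1) by exists (\max_(i <- r) i).+1.
  have := leq_bigmax_seq (P := xpredT) (F := id) _ sr isT; rewrite /= leqNgt.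
  by have [-> _] := sE (\max_(i <- r) i).+1.
move=> i; exists (\max_(m < choice.pickle i) s m).+1 => // n /= nbig [m _ mn].
rewrite -mn; apply: (sE m).2; rewrite leqNgt; apply/negP => mi.
move: nbig; rewrite /= -mn ltnNge => /negP; apply.
exact: (leq_bigmax (Ordinal mi)).
Qed.

(** One polynomial is close to [U]-many [g n] on [Q], hence also to the limit
    [h]; this makes the convergence uniform on [Q] up to a multiple of [e]. *)
Lemma ultra_uniform_on_good_cube {R : realType} {d k : nat}
    {Q : set 'rV[R]_d} {U : set_system nat} {g : nat -> 'rV[R]_d -> R}
    {h : 'rV[R]_d -> R} {B e : R} :
  UltraFilter U -> is_cube Q -> Q `<=` unit_cube R d ->
  (forall n x, unit_cube R d x -> `|g n x| <= B) ->
  (forall x, unit_cube R d x -> g n x @[n --> U] --> h x) ->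
  0 < e -> U [set n | (Ek k (g n) Q <= e%:E)%E] ->
  U [set n | forall x, Q x -> `|h x - g n x| <= 5 * e].
Proof.
move=> UU Qcube Q01 gB gh e0 UE.
have [q qk qE] := Ek_ultra_limit g UU Qcube Q01 gB e0 UE.
apply: filterS (qE) => n /= gq x Qx.
move/cvgrPdist_le : (gh x (Q01 x Qx)) => /(_ _ e0) hx.
have [n' [/= /(_ x Qx) gq' hg]] := filter_ex (filterI qE hx).
(* The index [n'] depends on [x]; it only serves to compare [h x] with [q]. *)
have -> : h x - g n x =
  (h x - g n' x) + (g n' x - peval q x) + (peval q x - g n x) by ring.
rewrite (le_trans (ler_normD _ _)) // (distrC (peval q x)).
have := ler_normD (h x - g n' x) (g n' x - peval q x).
have := gq x Qx; lra.
Qed.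

(** The set [A (m, j)] requires closeness on the finite exceptional set and on
    every good cell of level [j], so that for each [m] every point is controlled
    by some [A (m, j)]: countably many conditions for uncountably many points. *)
Lemma pointwise_convergent_subsequence {R : realType} {d k : nat} {p B C : R}
    {U : set_system nat} {g : nat -> 'rV[R]_d -> R} {h : 'rV[R]_d -> R} :
  UltraFilter U -> \oo `<=` U -> 0 < p ->
  (forall n x, unit_cube R d x -> `|g n x| <= B) ->
  (forall n, (Vseminorm k p (g n) <= C%:E)%E) ->
  (forall x, unit_cube R d x -> g n x @[n --> U] --> h x) ->
  exists2 J, infinite_set J &
    forall x, unit_cube R d x -> g n x @[n --> within J \oo] --> h x.
Proof.
move=> UU ooU p0 gB gC gh.
pose e (m : nat) : R := m.+1%:R^-1.
have e0 m : 0 < e m by rewrite invr_gt0 ltr0n.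
pose good m j (c : {ffun 'I_d -> 'I_j.+1}) :=
  U [set n | (Ek k (g n) (grid_cell R c) <= (e m)%:E)%E].
pose A (i : nat * nat) : set nat := [set n |
  (forall x, bad_points k U g (e i.1) x -> `|h x - g n x| <= e i.1) /\
  (forall c : {ffun 'I_d -> 'I_(i.2).+1}, good i.1 i.2 c ->
    forall x, grid_cell R c x -> `|h x - g n x| <= 5 * e i.1)].
have UA i : U (A i).
  apply: filterI.
    have finbad := finite_bad_points g UU p0 (e0 i.1) gC.
    have : \forall n \near U, forall x,
        x \in fset_set (bad_points k U g (e i.1)) -> `|h x - g n x| <= e i.1.
      apply: (@filter_bigI _ _ (fset_set (bad_points k U g (e i.1)))
        (fun x n => `|h x - g n x| <= e i.1)) => x.
      rewrite in_fset_set // => /set_mem[x01 _].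
      by move/cvgrPdist_le : (gh x x01); apply.
    apply: filterS => n /= hn x xbad; apply: hn.
    by rewrite in_fset_set //; exact: mem_set.
  apply: filter_forall => c.
  have [cgood|cbad] := pselect (good i.1 i.2 c); last first.
    by apply: filterE => n /cbad.
  have := ultra_uniform_on_good_cube UU (grid_cell_cube c)
    (grid_cell_sub c) gB gh (e0 i.1) cgood.
  by apply: filterS => n gn _.
have [J Jinf JA] := pseudo_intersection A (ultra_proper (F := U)) ooU UA.
exists J => // x x01; apply/cvgrPdist_le => eps eps0.
have eps5 : 0 < eps / 5 by rewrite divr_gt0.
have [m _ /(_ m (leqnn m))/= me] := near_infty_natSinv_lt (PosNum eps5).
have {}me : 5 * e m <= eps by rewrite mulrC -ler_pdivlMr // ltW.
have [xbad|xgood] := pselect (bad_points k U g (e m) x).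
  apply: filterS (JA (m, 0%N)) => n /= [/(_ x xbad) hn _].
  apply: le_trans hn (le_trans _ me).
  by have := e0 m; lra.
have [j [c [xc cgood]]] : exists j (c : {ffun 'I_d -> 'I_j.+1}),
    grid_cell R c x /\ good m j c.
  apply: contrapT => nex; apply: xgood; split=> // j c xc cgood.
  by apply: nex; exists j, c.
apply: filterS (JA (m, j)) => n /= [_ /(_ c cgood x xc) hn].
exact: le_trans hn me.
Qed.

(** * The compactness theorem *)

Lemma limf_einf_le {R : realType} {F : set_system nat} {u : nat -> \bar R}
    {M : \bar R} :
  ProperFilter F -> (forall n, u n <= M)%E -> (limf_einf u F <= M)%E.
Proof.
move=> FF uM; rewrite limf_einfE; apply: ge_ereal_sup => _ [V FV <-].
have [n Vn] := filter_ex FV.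
by apply: le_trans (uM n); apply: ereal_inf_lbound; exists n.
Qed.

Lemma unit_cube_is_cube {R : realType} {d : nat} : is_cube (unit_cube R d).
Proof.
exists 0, 1; split; first exact: ltr01.
apply/seteqP; split => [x x01|_ [x x01 <-]]; last by rewrite add0r scale1r.
by exists x => //; rewrite add0r scale1r.
Qed.

Theorem corollary2p4 (R : realType) (d k : nat) (p : R)
    (d_gt0 : (0 < d)%N) (k_gt0 : (0 < k)%N) (p_ge1 : 1 <= p)
    (dpk : d%:R / p <= k%:R)
    (f : nat -> 'rV[R]_d -> R)
    (fV : forall n, Vspace R d k p (f n))
    (f_bounded : (ereal_sup (range (fun n => Vseminorm k p (f n))) < +oo)%E) :
  exists (J : set nat) (q : nat -> mpoly.mpoly d R) (g : 'rV[R]_d -> R),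
    [/\ infinite_set J,
        forall n, J n -> polys R d k (q n),
        forall x, unit_cube R d x ->
          (fun n => f n x + peval (q n) x) @ within J \oo --> g x,
        Vspace R d k p g &
        (Vseminorm k p g
           <= limf_einf (fun n => Vseminorm k p (f n)) (within J \oo))%E].
Proof.
have p0 : 0 < p := lt_le_trans ltr01 p_ge1.
have [C fC] : exists C : R, forall n, (Vseminorm k p (f n) <= C%:E)%E.
  have fM n : (Vseminorm k p (f n) <=
      ereal_sup (range (fun n => Vseminorm k p (f n))))%E.
    by apply: ereal_sup_ubound; exists n.
  move: f_bounded fM; case: ereal_sup => [C _|//|_] fM; first by exists C.
  by exists 0 => n; apply: le_trans (fM n) _; rewrite leNye.
have /choice[q qE] n : exists q, polys R d k q /\
    forall x, unit_cube R d x -> `|f n x + peval q x| <= C + 1.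
  have /Ek_lt[m mk fm] : (Ek k (f n) (unit_cube R d) < (C + 1)%:E)%E.
    apply: le_lt_trans (Ek_le_Vseminorm p0 unit_cube_is_cube _) _ => //.
    by apply: le_lt_trans (fC n) _; rewrite lte_fin ltrDl.
  (* The correcting polynomial is the opposite of a near-best approximation. *)
  exists (- m); split; first exact: polys_opp.
  by move=> x /fm; rewrite /peval mpoly.mevalN.
pose g n x := f n x + peval (q n) x.
have gV n : Vseminorm k p (g n) = Vseminorm k p (f n).
  by apply: Vseminorm_addpolys; have [] := qE n.
have gB n x : unit_cube R d x -> `|g n x| <= C + 1.
  by have [_] := qE n; apply.
have gC n : (Vseminorm k p (g n) <= C%:E)%E by rewrite gV.
have [U [UU ooU]] := ultraFilterLemma eventually_filter.
have /choice[h gh] x : exists l : R, unit_cube R d x -> g n x @[n --> U] --> l.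
  have [x01|nx] := pselect (unit_cube R d x); last by exists 0 => /nx.
  have [l gl] := bounded_ultra_cvg (fun n => g n x) (C + 1) UU (gB ^~ x ^~ x01).
  by exists l.
have [J Jinf Jgh] := pointwise_convergent_subsequence UU ooU p0 gB gC gh.
have JF := infinite_within_proper Jinf.
have lsc : (Vseminorm k p h
    <= limf_einf (fun n => Vseminorm k p (f n)) (within J \oo))%E.
  under [X in limf_einf X]eq_fun do rewrite -gV.
  exact: Vseminorm_lower_semicontinuous JF p0 gB Jgh.
exists J, q, h; split => //; first by move=> n _; have [] := qE n.
split; last exact: le_lt_trans lsc (le_lt_trans (limf_einf_le JF fC) (ltry C)).
exists (C + 1); split; first exact: num_real.
move=> M CM x x01 /=; apply: le_trans (ltW CM).
exact: cvg_norm_le (gh x x01) (gB ^~ x ^~ x01).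
Qed.
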